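(* Let $G=(V,E)$ be a connected undirected graph without loops. Then: (i) two distinct vertices $v,v'\in V$ are structurally equivalent if and only if the Ollivier–Ricci curvature satisfies $\kappa(v,v')=1$; (ii) every structural class of $G$ is the vertex set of a complete subgraph of a connected component of $G_2$, i.e. any two distinct vertices in the same structural class are adjacent in $G_2$.
   Context: An undirected graph without loops is $G=(V,E)$ with $E$ a set of $2$-element subsets of $V$. Two vertices $a,b$ are structurally equivalent if for every vertex $c$, $\{a,c\}\in E$ iff $\{b,c\}\in E$ (i.e. they have the same set of neighbours); the structural classes are the equivalence classes of this relation. A path of length $n$ is a sequence of pairwise distinct vertices $x_0,\dots,x_n$ with $\{x_i,x_{i+1}\}\in E$; $G_2=(V,E_2)$ has $\{u,v\}\in E_2$ iff there is a path of length $2$ in $G$ between $u$ and $v$. $d_{SP}$ is the shortest-path distance in $G$ and $d_x$ the degree of $x$. For $x\in V$, $\mu_x$ is the probability measure on $V$ with $\mu_x(z)=1/d_x$ if $z$ is a neighbour of $x$ and $0$ otherwise. $W_1(\mu_x,\mu_y)=\min_{\xi}\sum_{u,v}d_{SP}(u,v)\xi(u,v)$, the minimum over couplings $\xi:V\times V\to[0,1]$ with marginals $\mu_x$ and $\mu_y$. For distinct $x,y$, $\kappa(x,y)=1-W_1(\mu_x,\mu_y)/d_{SP}(x,y)$. *)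

(* Defs.v *)
From HB Require Import structures.
From mathcomp Require Import all_boot all_order all_algebra finmap.
From mathcomp Require Import mathcomp_extra boolp classical_sets functions.
From mathcomp Require Import cardinality reals ereal esum.

Set Implicit Arguments.
Unset Strict Implicit.
Unset Printing Implicit Defensive.

Import Order.TTheory GRing.Theory Num.Theory.
Local Open Scope classical_set_scope.
Local Open Scope ring_scope.

(* An undirected loopless graph on [V] is a symmetric irreflexive adjacency
   relation [e : rel V]; [e u v] reads {u, v} \in E.  [V] may be infinite. *)

Section Graphs.
Variables (V : choiceType) (e : rel V).

Definition is_path (n : nat) (x y : V) : Prop :=
  exists p : seq V,
    [/\ size p = n, uniq (x :: p), path e x p & last x p = y].

Definition joined (x y : V) : Prop := exists n, is_path n x y.

Definition connected_graph : Prop := forall x y, joined x y.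

Definition is_component (K : set V) : Prop :=
  exists x, K = [set y | joined x y].

Definition complete_on (C : set V) : Prop :=
  forall u v, C u -> C v -> u <> v -> e u v.

Definition nbrs (x : V) : set V := [set z | e x z].

Definition locally_finite : Prop := forall x, finite_set (nbrs x).

Definition struct_equiv (a b : V) : Prop := forall c, e a c = e b c.

Definition is_struct_class (C : set V) : Prop :=
  exists a, C = [set b | struct_equiv a b].

Definition G2 : rel V := fun u v => `[< is_path 2 u v >].

(* The default 0 is taken only when no path joins [u] and [v]. *)
Definition dSP (u v : V) : nat :=
  xget 0%N [set n | is_path n u v /\ forall m, is_path m u v -> (n <= m)%N].

(* [fset_set A] has the elements of [A] only when [A] is finite. *)
Definition degree (x : V) : nat := #|` fset_set (nbrs x)|.

End Graphs.

Section Curvature.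
Variables (R : realType) (V : choiceType) (e : rel V).

Definition mu (x z : V) : R := if e x z then (degree e x)%:R^-1 else 0.

Definition coupling (m1 m2 : V -> R) : set (V * V -> R) :=
  [set xi | [/\ forall p, 0 <= xi p <= 1,
    forall u, \esum_(v in [set: V]) (xi (u, v))%:E = (m1 u)%:E &
    forall v, \esum_(u in [set: V]) (xi (u, v))%:E = (m2 v)%:E]].

Definition cost (xi : V * V -> R) : \bar R :=
  \esum_(p in [set: V * V]) ((dSP e p.1 p.2)%:R * xi p)%:E.

(* For finitely supported marginals the infimum is a minimum. *)
Definition W1 (m1 m2 : V -> R) : \bar R :=
  ereal_inf [set cost xi | xi in coupling m1 m2].

(* W1 is extended-real valued, hence so is the curvature; in a connected
   locally finite graph both are finite for x <> y. *)
Definition kappa (x y : V) : \bar R :=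
  (1 - W1 (mu x) (mu y) * ((dSP e x y)%:R^-1)%:E)%E.

End Curvature.

(* Main.v *)
(** Structurally equivalent vertices carry the same measure, and the diagonal
    coupling then has cost [0].  Conversely, a coupling of [m1] and [m2] moves
    at least [|m1 u - m2 u|] of mass across the diagonal at each vertex [u],
    over a distance of at least [1]; hence [W1 m1 m2 = 0] forces [m1 = m2], and
    the neighbourhood of a vertex is the support of its measure.  For the second
    part, any neighbour shared by two equivalent vertices is the midpoint of a
    path of length [2]. *)

Require Import Defs.
From HB Require Import structures.
From mathcomp Require Import all_boot all_order all_algebra finmap.
From mathcomp Require Import mathcomp_extra boolp classical_sets functions.
From mathcomp Require Import cardinality reals ereal esum.

Set Implicit Arguments.
Unset Strict Implicit.
Unset Printing Implicit Defensive.

Import Order.TTheory GRing.Theory Num.Theory.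
Local Open Scope classical_set_scope.
Local Open Scope ring_scope.

Lemma esum_supp1 (R : realType) (T : choiceType) (t : T) (a : T -> \bar R) :
  (0 <= a t)%E -> (forall i, i <> t -> a i = 0%E) ->
  \esum_(i in [set: T]) a i = a t.
Proof.
move=> at0 a0; rewrite -(esum_set1 at0) [RHS]esum_mkcond.
by apply: eq_esum => i _; case: ifPn => //; rewrite notin_setE => /a0.
Qed.

Lemma esum_ge_term (R : realType) (T : choiceType) (t : T) (a : T -> \bar R) :
  (forall i, 0 <= a i)%E -> (a t <= \esum_(i in [set: T]) a i)%E.
Proof.
move=> a0; rewrite -(esum_set1 (a0 t)) esum_mkcond.
by apply: le_esum => i _; case: ifP.
Qed.

Lemma esum_comp_le (R : realType) (T T' : choiceType) (f : T -> T')
    (a : T' -> \bar R) : injective f -> (forall j, 0 <= a j)%E ->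
  (\esum_(i in [set: T]) a (f i) <= \esum_(j in [set: T']) a j)%E.
Proof.
move=> finj a0; rewrite -esum_image; last by move=> x y _ _ /finj.
by rewrite esum_mkcond; apply: le_esum => j _; case: ifP.
Qed.

(** Away from [t] the weight only enlarges a term; the term at [t], where the weight may vanish, is
    paid for separately. Meant for [c] a row or column of a coupling and [d] the distance to [t]. *)
Lemma esum_le_weighted (R : realType) (T : choiceType) (t : T) (c d : T -> R) :
  (forall i, 0 <= c i) -> (forall i, 0 <= d i) ->
  (forall i, i <> t -> 1 <= d i) ->
  (\esum_(i in [set: T]) (c i)%:E <=
   (c t)%:E + \esum_(i in [set: T]) (d i * c i)%:E)%E.
Proof.
move=> c0 d0 d1.
have ct0 : (0 <= (c t)%:E)%E by rewrite lee_fin.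
rewrite -(@esum_set1 _ _ t (fun i => (c i)%:E) ct0) [X in (_ <= X + _)%E]esum_mkcond.
rewrite -esumD.
- apply: le_esum => i _; case: ifPn => [_|].
    by rewrite -EFinD lee_fin lerDl mulr_ge0.
  by rewrite notin_setE add0e lee_fin => /d1; exact: ler_peMl.
- by move=> i _; case: ifP; rewrite ?lee_fin.
- by move=> i _; rewrite lee_fin mulr_ge0.
Qed.

Section GraphFacts.
Variables (V : choiceType) (e : rel V).

Lemma is_path0 (x : V) : is_path e 0 x x.
Proof. by exists [::]. Qed.

Lemma dSPxx (x : V) : dSP e x x = 0%N.
Proof.
rewrite /dSP; case: xgetP => // n -> [_ /(_ 0%N (is_path0 x))].
by rewrite leqn0 => /eqP.
Qed.

Lemma dSP_gt0 (x y : V) : joined e x y -> x <> y -> (0 < dSP e x y)%N.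
Proof.
move=> [n xy] xNy; rewrite /dSP; case: xgetP => [m -> [[p [<- _ _]]]|noP].
  by case: p => [/xNy|].
(* Some path length exists, hence a least one, so the default 0 of [xget] cannot occur. *)
have exP : exists n, `[< is_path e n x y >] by exists n; apply/asboolP.
case: (ex_minnP exP) => m /asboolP mP min; exfalso; apply: (noP m).
by split=> // k kP; apply/min/asboolP.
Qed.

Lemma degree_gt0 (x y : V) :
  finite_set (nbrs e x) -> e x y -> (0 < degree e x)%N.
Proof.
move=> fx exy; rewrite /degree cardfs_gt0; apply/fset0Pn; exists y.
by rewrite in_fset_set// inE.
Qed.

Lemma struct_equiv_degree (x y : V) :
  struct_equiv e x y -> degree e x = degree e y.
Proof.
by move=> xy; rewrite /degree /nbrs; under eq_set do rewrite xy.
Qed.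

Lemma struct_equiv_G2 (x y : V) : symmetric e -> irreflexive e ->
  joined e x y -> struct_equiv e x y -> x <> y -> G2 e x y.
Proof.
(* As [x <> y], the joining path is nonempty; its first step [c] is a neighbour of [x], hence also
   of [y]. *)
move=> esym eirr [n [[|c p] [_ _ /= pth lst]]] xy xNy; first by case: xNy.
case/andP: pth => xc _; have yc : e y c by rewrite -xy.
apply/asboolP; exists [:: c; y]; split => //=; last by rewrite xc esym yc.
rewrite !inE !negb_or !andbT -andbA; apply/and3P; split.
- by apply/eqP => xc'; rewrite xc' eirr in xc.
- exact/eqP.
- by apply/eqP => cy; rewrite cy eirr in yc.
Qed.

End GraphFacts.

Section Transport.
Variables (R : realType) (V : choiceType) (e : rel V).
Implicit Types (m : V -> R) (xi : V * V -> R).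

Lemma cost_ge0 xi : (forall p, 0 <= xi p) -> (0 <= cost e xi)%E.
Proof. by move=> xi0; apply: esum_ge0 => p _; rewrite lee_fin mulr_ge0. Qed.

Lemma W1_ge0 m1 m2 : (0 <= W1 e m1 m2)%E.
Proof.
apply: le_ereal_inf_tmp => _ [xi [xi01 _ _] <-].
by apply: cost_ge0 => p; case/andP: (xi01 p).
Qed.

Lemma W1_diag m : (forall z, 0 <= m z <= 1) -> W1 e m m = 0%E.
Proof.
move=> m01; apply/eqP; rewrite eq_le W1_ge0 andbT.
pose xi (p : V * V) : R := if p.1 == p.2 then m p.1 else 0.
have m0 z : 0 <= m z by case/andP: (m01 z).
apply: ereal_inf_lbound; exists xi.
  split=> [p|u|u]; first by rewrite /xi; case: eqP; rewrite ?lexx ?ler01.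
  - rewrite (@esum_supp1 _ _ u); rewrite /xi /= ?eqxx ?lee_fin//.
    by move=> i iNu; case: eqP => // ui; case: iNu.
  - rewrite (@esum_supp1 _ _ u); rewrite /xi /= ?eqxx ?lee_fin//.
    by move=> i; case: eqP.
apply: esum1 => -[u v] _; rewrite /xi /=; case: eqP => [->|_].
  by rewrite dSPxx mul0r.
by rewrite mulr0.
Qed.

Hypothesis e_conn : connected_graph e.

(** Row [u] of [xi] has sum [m1 u]. Its diagonal entry also lies in column [u], so is at most
    [m2 u]; the other entries travel distance at least 1. Exchanging rows and columns gives the
    second bound. *)
Lemma marginal_le_cost m1 m2 xi u : coupling m1 m2 xi ->
  ((m1 u)%:E <= (m2 u)%:E + cost e xi)%E /\
  ((m2 u)%:E <= (m1 u)%:E + cost e xi)%E.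
Proof.
move=> [xi01 xi1 xi2].
have xi0 p : 0 <= xi p by case/andP: (xi01 p).
have cost0 (p : V * V) : (0 <= ((dSP e p.1 p.2)%:R * xi p)%:E)%E.
  by rewrite lee_fin mulr_ge0.
split.
- rewrite -xi1; apply: le_trans
    (@esum_le_weighted _ _ u _ (fun v => (dSP e u v)%:R) _ _ _) _ => //.
    by move=> v vNu; rewrite ler1n dSP_gt0// => uv; apply: vNu.
  apply: leeD.
    rewrite -xi2; apply: (@esum_ge_term _ _ u (fun v => (xi (v, u))%:E)) => v.
    by rewrite lee_fin.
  (* Row [u] embeds in [V * V], so its share of the cost is at most the whole. *)
  by apply: (@esum_comp_le _ _ _ (pair u) _ _ cost0) => v w [].
- rewrite -xi2; apply: le_trans
    (@esum_le_weighted _ _ u _ (fun v => (dSP e v u)%:R) _ _ _) _ => //.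
    by move=> v vNu; rewrite ler1n dSP_gt0.
  apply: leeD.
    rewrite -xi1; apply: (@esum_ge_term _ _ u (fun v => (xi (u, v))%:E)) => v.
    by rewrite lee_fin.
  by apply: (@esum_comp_le _ _ _ (pair^~ u) _ _ cost0) => v w [].
Qed.

Lemma W1_eq0 m1 m2 : W1 e m1 m2 = 0%E -> m1 =1 m2.
Proof.
(* Writing 0 as [W1 e m1 m2] reduces the claim to bounding [|m1 u - m2 u|] by the cost of every
   coupling. *)
move=> W0 u; apply/eqP; rewrite -subr_eq0 -normr_le0 -lee_fin -[leRHS]W0.
apply: le_ereal_inf_tmp => _ [xi /(marginal_le_cost u)[] + + <-].
(* The bound is trivial at [+oo], and [-oo] contradicts the two inequalities. *)
case: (cost e xi) => [r| |]; rewrite ?leey// -?EFinD ?lee_fin//.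
by move=> h1 h2; rewrite ler_distl lerBlDr h2.
Qed.

Lemma kappa_eq1 x y : x <> y ->
  kappa R e x y = 1%:E <-> W1 e (mu R e x) (mu R e y) = 0%E.
Proof.
move=> xNy; rewrite /kappa; split=> [|->]; last by rewrite mul0e sube0.
(* The distance is positive, so its inverse is not the default 0 and can be cancelled. *)
have d0 : (dSP e x y)%:R^-1 != 0 :> R.
  by rewrite invr_eq0 pnatr_eq0 -lt0n dSP_gt0.
set z := (_ * _)%E => k1.
have /eqP : z = 0%E.
  (* An infinite [z] would make [1 - z] infinite, so only real [z] remains. *)
  by case: z k1 => //= s [/eqP]; rewrite subr_eq addrC -subr_eq subrr => /eqP <-.
by rewrite mule_eq0 eqe (negPf d0) orbF => /eqP.
Qed.

End Transport.

Theorem theorem3p4 (R : realType) (V : choiceType) (e : rel V)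
    (e_sym : symmetric e) (e_irr : irreflexive e)
    (e_conn : connected_graph e) :
  (locally_finite e ->
   forall v v' : V, v <> v' ->
     (struct_equiv e v v' <-> kappa R e v v' = 1%:E)) /\
  (forall C : set V, is_struct_class e C ->
     exists K : set V,
       [/\ is_component (G2 e) K, C `<=` K & complete_on (G2 e) C]).
Proof.
split=> [lf v v' vNv'|C [a ->]].
  rewrite kappa_eq1//; split=> [vv'|W0 c].
    have -> : mu R e v' = mu R e v.
      by apply/funext => z; rewrite /mu vv' (struct_equiv_degree vv').
    apply: W1_diag => z; rewrite /mu; case: ifP => [vz|]; last first.
      by rewrite lexx ler01.
    by rewrite invr_ge0 ler0n invf_le1 ?ltr0n ?ler1n (degree_gt0 (lf v) vz).
  (* Local finiteness makes [degree] a true count, positive once a neighbour exists, so [mu] is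
     nonzero there. *)
  have supp x : e x c = (mu R e x c != 0).
    rewrite /mu; case: ifP => [xc|]; last by rewrite eqxx.
    by rewrite invr_eq0 pnatr_eq0 -lt0n (degree_gt0 (lf x) xc).
  by rewrite !supp (W1_eq0 e_conn W0).
have cmpl : complete_on (G2 e) [set b | struct_equiv e a b].
  by move=> u v au av; apply: struct_equiv_G2 => // c; rewrite -au av.
(* The component of [a] works: by completeness, class members are at most one [G2] edge from [a]. *)
exists [set y | joined (G2 e) a y]; split=> //; first by exists a.
move=> b ab /=; have [<-|aNb] := eqVneq a b; first by exists 0%N; exact: is_path0.
exists 1%N, [:: b]; split=> //=; first by rewrite inE andbT.
by rewrite andbT; apply: cmpl => //; exact/eqP.
Qed.
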